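(* The Stokes-Sibuya connection matrices satisfy the functional relation $$\mathfrak{S}_0(\underline a)\mathfrak{S}_1(\underline a)\cdots\mathfrak{S}_{m-1}(\underline a)=M_0(\underline a',p)\,\mathfrak{M}^{-1}(\underline a',p)\,M_0^{-1}(\underline a',p).$$
   Context: $m\ge1$ is an integer; $(\mathfrak{E}_m)$ is the equation $\Phi''(x)=\frac{P_m(x,\underline a)}{x^2}\Phi(x)$, $P_m(x,\underline a)=x^m+a_1x^{m-1}+\cdots+a_m$, $\underline a\in\mathbb{C}^m$; $x$ lies on the universal covering of $\mathbb{C}^\star$. $\omega=e^{2i\pi/m}$, $\omega^c:=e^{2i\pi c/m}$, $\lambda.\underline a:=(\lambda a_1,\dots,\lambda^ma_m)$. Solutions at infinity: define $b_{\frac m2-k}(\underline a)$ by $\frac{\sqrt{P_m(x,\underline a)}}{x}=x^{\frac m2-1}+\sum_{k\ge1}b_{\frac m2-k}(\underline a)x^{\frac m2-k-1}$ at infinity; $r(\underline a)=\frac12-\frac m4$ ($m$ odd), $r(\underline a)=\frac12-\frac m4-b_0(\underline a)$ ($m$ even); $S(x,\underline a)=\frac2mx^{\frac m2}+\sum_{1\le k<m/2}\frac{b_{\frac m2-k}(\underline a)}{\frac m2-k}x^{\frac m2-k}$. $\Phi_0(x,\underline a)$ is the unique solution of $(\mathfrak{E}_m)$ asymptotic at infinity to $x^{r(\underline a)}e^{-S(x,\underline a)}\phi_0$ ($\phi_0$ a formal series in $x^{-1/2}$, resp. $x^{-1}$ for $m$ even, with constant term $1$) in every strict sub-sector of $\{|\arg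 x|<3\pi/m\}$, locally uniformly in $\underline a$; it extends analytically to the universal covering of $\mathbb{C}^\star$ and is entire in $\underline a$. $\Phi_k(x,\underline a)=\Phi_0(\omega^kx,\omega^k.\underline a)$, and $\mathfrak{S}_k(\underline a)$ is defined by $\begin{pmatrix}\Phi_{k-1}\\ \Phi_k\end{pmatrix}=\mathfrak{S}_k(\underline a)\begin{pmatrix}\Phi_k\\ \Phi_{k+1}\end{pmatrix}$. Solutions at the origin: $\underline a'=(a_1,\dots,a_{m-1})$, $p=(1+4a_m)^{1/2}$ (so $a_m=\frac{p^2-1}4$), the root being chosen so that $-p\notin\mathbb{N}^\star$, and $s(p)=\frac{1+p}2$. $(f_1,f_2)$ is the fundamental system of solutions uniquely determined by $f_1=x^{s(p)}(1+\sum_{k\ge1}A_kx^k)$ and $f_2=\lambda(\underline a',p)f_1\ln x+x^{s(-p)}g_2$ with $g_2$ entire in $x$, where: if $p\notin\mathbb{Z}$, $\lambda=0$ and $g_2(x,\underline a',p)=g_1(x,\underline a',-p)$ with $g_1=x^{-s(p)}f_1$; if $p\in\mathbb{N}^\star$, $g_2=1+\sum_{k\ge1}B_kx^k$ with $B_p=0$; if $p=0$, $\lambda=1$ and $g_2(0)=0$. The monodromy matrix at the origin is $\mathfrak{M}(\underline a',p)=\begin{pmatrix}e^{2i\pi s(p)}&0\\ 2i\pi\lambda(\underline a',p)e^{2i\pi s(-p)}&e^{2i\pi s(-p)}\end{pmatrix}$, which satisfies $\begin{pmatrix}f_1\\ f_2\end{pmatrix}(\omega^mx)=\mathfrak{M}(\underline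 a',p)\begin{pmatrix}f_1\\ f_2\end{pmatrix}(x)$. The $0\infty$-connection matrix $M_k(\underline a',p)$ (invertible) is defined by $\begin{pmatrix}\Phi_{k-1}\\ \Phi_k\end{pmatrix}(x,\underline a)=M_k(\underline a',p)\begin{pmatrix}f_1\\ f_2\end{pmatrix}(x,\underline a',p)$. *)

(* Defs.v *)
From HB Require Import structures.
From mathcomp Require Import all_boot all_order all_algebra.
From mathcomp Require Import complex.
From mathcomp Require Import all_classical all_reals all_analysis.

Set Implicit Arguments.
Unset Strict Implicit.
Unset Printing Implicit Defensive.

Import Order.TTheory GRing.Theory Num.Theory.
Import numFieldNormedType.Exports.

Local Open Scope classical_set_scope.
Local Open Scope ring_scope.
Local Open Scope complex_scope.

(* The usual topology of the complex plane, so that limits, [derivable] and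
   [differentiable] below are those of complex analysis. *)
HB.instance Definition _ (R : rcfType) := NormedModule.copy R[i] R[i]^o.

(* A point [x] of the universal covering of C^* is represented by its
   logarithm [t] : C, the covering map being [cexp].  Hence |x| = |cexp t|,
   arg x = Im t, ln x = t, and a function on the covering is a function of
   [t].  Rotating [x] by e^(2 i pi c / m) on the covering adds 2 i pi c / m
   to [t]; in particular a full turn acts nontrivially. *)

Section Definitions.
Variable R : realType.
Local Notation C := R[i].

Definition cexp (z : C) : C :=
  (expR (complex.Re z) * cos (complex.Im z)) +i* (expR (complex.Re z) * sin (complex.Im z)).

Definition twopii : C := 0 +i* (2 * pi).

(* x^s on the covering, x = e^t *)
Definition upow (t s : C) : C := cexp (s * t).

Definition rot (m : nat) (c : int) (t : C) : C := t + twopii * c%:~R / m%:R.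

(* d/dx on functions of t = ln x *)
Definition ddx (F : C -> C) (t : C) : C := 'D_1 F t / cexp t.

(* The entry of index j - 1 of [a] is a_j. *)
Definition Pm (m : nat) (a : 'rV[C]_m) (x : C) : C :=
  x ^+ m + \sum_(i < m) a 0 i * x ^+ (m - i.+1).

Definition is_solution (m : nat) (a : 'rV[C]_m) (F : C -> C) : Prop :=
  [/\ forall t, derivable F t 1,
      forall t, derivable (ddx F) t 1 &
      forall t, ddx (ddx F) t = Pm a (cexp t) / cexp t ^+ 2 * F t].

Definition fundamental_system (m : nat) (a : 'rV[C]_m) (F G : C -> C) : Prop :=
  [/\ is_solution a F, is_solution a G &
      forall c d : C, (forall t, c * F t + d * G t = 0) -> c = 0 /\ d = 0].

(* omega^c = e^(2 i pi c / m) *)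
Definition omega (m : nat) (c : int) : C := cexp (twopii * c%:~R / m%:R).

Definition act (m : nat) (l : C) (a : 'rV[C]_m) : 'rV[C]_m :=
  \row_(i < m) (l ^+ i.+1 * a 0 i).

(* [b a k] stands for b_(m/2 - k)(a), k >= 1; [b a 0] is not used.  The sum of
   the series is a square root of P_m(x, a) / x^2, the branch being fixed by
   its leading term x^(m/2 - 1). *)
Definition sqrt_expansion (m : nat) (b : 'rV[C]_m -> nat -> C) : Prop :=
  forall a, exists rho : R, forall t : C, rho%:C < `|cexp t| ->
    exists2 w : C, w ^+ 2 = Pm a (cexp t) / cexp t ^+ 2 &
      (fun n : nat => upow t (m%:R / 2 - 1)
         + \sum_(1 <= k < n) b a k * upow t (m%:R / 2 - k%:R - 1)) @ \oo --> w.

Section AtInfinity.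
Variables (m : nat) (b : 'rV[C]_m -> nat -> C).

Definition r_inf (a : 'rV[C]_m) : C :=
  if odd m then 1 / 2 - m%:R / 4 else 1 / 2 - m%:R / 4 - b a m./2.

Definition S_inf (t : C) (a : 'rV[C]_m) : C :=
  2 / m%:R * upow t (m%:R / 2)
  + \sum_(1 <= k < m | (k.*2 < m)%N)
      b a k / (m%:R / 2 - k%:R) * upow t (m%:R / 2 - k%:R).

Definition step_inf : C := if odd m then 1 / 2 else 1.

(* Poincare asymptotics to x^r e^(-S) phi_0, where phi_0 is the formal series
   of the c_n(a) x^(- n step_inf): [alpha, beta] is the range of arguments of a
   strict sub-sector, and the constants are uniform for [a] near [a0]. *)
Definition asymptotic_inf (Phi0 : C -> 'rV[C]_m -> C) : Prop :=
  exists c : nat -> 'rV[C]_m -> C,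
    (forall a, c 0%N a = 1) /\
    forall alpha beta : R,
      - (3 * pi / m%:R) < alpha -> beta < 3 * pi / m%:R ->
    forall (N : nat) (a0 : 'rV[C]_m), exists K rho : R,
      \forall a \near a0, forall t : C,
        alpha <= complex.Im t <= beta -> rho%:C < `|cexp t| ->
        `| Phi0 t a / (upow t (r_inf a) * cexp (- S_inf t a))
           - \sum_(n < N) c n a * upow t (- (n%:R * step_inf)) |
        <= K%:C * `|upow t (- (N%:R * step_inf))|.

Definition is_Phi0 (Phi0 : C -> 'rV[C]_m -> C) : Prop :=
  [/\ forall a, is_solution a (Phi0 ^~ a),
      asymptotic_inf Phi0 &
      forall t a, differentiable (Phi0 t) a].

End AtInfinity.

Definition Phi (m : nat) (Phi0 : C -> 'rV[C]_m -> C) (k : int) (t : C)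
  (a : 'rV[C]_m) : C := Phi0 (rot m k t) (act (omega m k) a).

Definition col2 (u v : C) : 'cV[C]_2 := \col_(i < 2) (if i == 0 then u else v).

Definition mx2 (u v w z : C) : 'M[C]_2 :=
  \matrix_(i < 2, j < 2)
    (if i == 0 then (if j == 0 then u else v) else (if j == 0 then w else z)).

Definition is_Stokes_Sibuya (m : nat) (Phi0 : C -> 'rV[C]_m -> C)
  (S : int -> 'rV[C]_m -> 'M[C]_2) : Prop :=
  forall k a t,
    col2 (Phi Phi0 (k - 1) t a) (Phi Phi0 k t a)
    = S k a *m col2 (Phi Phi0 k t a) (Phi Phi0 (k + 1) t a).

Definition admissible (p : C) : Prop :=
  forall n : nat, (0 < n)%N -> - p <> n%:R.

Definition s_exp (p : C) : C := (1 + p) / 2.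

(* a = (a', a_m) with a_m = (p^2 - 1) / 4 *)
Definition param (m : nat) (a' : 'rV[C]_m.-1) (p : C) : 'rV[C]_m :=
  \row_(i < m) (if insub (i : nat) : option 'I_m.-1 is Some j then a' 0 j
                else (p ^+ 2 - 1) / 4).

(* [g] is entire with Taylor coefficients [A] at 0. *)
Definition entire_series (A : nat -> C) (g : C -> C) : Prop :=
  forall z : C, series (fun k : nat => A k * z ^+ k) @ \oo --> g z.

(* For p not an integer, -p is admissible too, so g1 at -p makes sense. *)
Definition origin_system (m : nat) (f1 f2 : C -> 'rV[C]_m.-1 -> C -> C)
  (lambda : 'rV[C]_m.-1 -> C -> C) : Prop :=
  exists g1 g2 : C -> 'rV[C]_m.-1 -> C -> C,
  forall (a' : 'rV[C]_m.-1) (p : C), admissible p ->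
  [/\ fundamental_system (param a' p) (fun t => f1 t a' p) (fun t => f2 t a' p),
      forall t, f1 t a' p = upow t (s_exp p) * g1 (cexp t) a' p,
      forall t, f2 t a' p = lambda a' p * f1 t a' p * t
                            + upow t (s_exp (- p)) * g2 (cexp t) a' p,
      exists2 A : nat -> C, A 0%N = 1 & entire_series A (fun z => g1 z a' p) &
      exists2 B : nat -> C, entire_series B (fun z => g2 z a' p) &
        [/\ (forall n : int, p <> n%:~R) ->
              lambda a' p = 0 /\ forall z, g2 z a' p = g1 z a' (- p),
            forall n : nat, (0 < n)%N -> p = n%:R -> B 0%N = 1 /\ B n = 0 &
            p = 0 -> lambda a' p = 1 /\ g2 0 a' p = 0]].

Definition monodromy (m : nat) (lambda : 'rV[C]_m.-1 -> C -> C)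
  (a' : 'rV[C]_m.-1) (p : C) : 'M[C]_2 :=
  mx2 (cexp (twopii * s_exp p)) 0
      (twopii * lambda a' p * cexp (twopii * s_exp (- p)))
      (cexp (twopii * s_exp (- p))).

Definition is_connection (m : nat) (Phi0 : C -> 'rV[C]_m -> C)
  (f1 f2 : C -> 'rV[C]_m.-1 -> C -> C)
  (M : int -> 'rV[C]_m.-1 -> C -> 'M[C]_2) : Prop :=
  forall (k : int) (a' : 'rV[C]_m.-1) (p : C), admissible p -> forall t,
    col2 (Phi Phi0 (k - 1) t (param a' p)) (Phi Phi0 k t (param a' p))
    = M k a' p *m col2 (f1 t a' p) (f2 t a' p).

End Definitions.

(* Main.v *)
Require Import Defs.
From HB Require Import structures.
From mathcomp Require Import all_boot all_order all_algebra.
From mathcomp Require Import complex.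
From mathcomp Require Import all_classical all_reals all_analysis.
From mathcomp Require Import ring lra.

Set Implicit Arguments.
Unset Strict Implicit.
Unset Printing Implicit Defensive.

Import Order.TTheory GRing.Theory Num.Theory.

Local Open Scope ring_scope.
Local Open Scope complex_scope.

(** Write Y_k for the column (Phi_(k-1), Phi_k).  The Stokes relations
    telescope to Y_0 = S_0 S_1 ... S_(m-1) Y_m ([prod_Stokes_Sibuya]).  Since
    omega^m = 1 while a rotation by m times 2 pi / m is a full turn of the
    covering, Y_m is Y_0 continued once around the origin ([Phi_full_turn]).
    With F = (f_1, f_2), so that Y_0 = M_0 F, this continuation is M_0 N F,
    where N is the monodromy matrix ([monodromyP]).  Thus
    M_0 F = (S_0 ... S_(m-1)) M_0 N F, and F may be cancelled because f_1 and
    f_2 are linearly independent.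

    Solving M_0 = (S_0 ... S_(m-1)) M_0 N for the product requires N and M_0 to
    be invertible.  N is triangular with exponentials on the diagonal.  For
    M_0, the functions Phi_(-1) and Phi_0 must be linearly independent, which
    their behaviour on the positive real axis shows.  Phi_0 decays there like
    exp(- (2/m) x^(m/2)), whereas Phi_(-1)(x) is a value of Phi_0 on the ray of
    argument - 2 pi / m, where x^(m/2) has changed sign, so that Phi_(-1) grows
    like exp((2/m) |x|^(m/2)).  For independence it is enough that the first is
    bounded ([Phi0_recessive]) and the second is not ([Phi0_dominant]).  Both
    rays lie in the sector |arg x| < 3 pi / m where the asymptotics hold, and
    the leading term of the expansion suffices. *)

(** * The exponential coordinate on the covering of the punctured plane *)

Section Cexp.
Variable R : realType.
Implicit Types z w t : R[i].

Lemma cexp0 : cexp (0 : R[i]) = 1.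
Proof. by rewrite /cexp /= expR0 cos0 sin0 mul1r mulr0. Qed.

Lemma cexpD z w : cexp (z + w) = cexp z * cexp w.
Proof.
case: z w => [x y] [u v]; rewrite /cexp /= expRD cosD sinD.
by apply/eqP; rewrite eq_complex /=; apply/andP; split; apply/eqP; ring.
Qed.

Lemma norm_cexp z : `|cexp z| = (expR (complex.Re z))%:C.
Proof.
rewrite normc_def /cexp /= !exprMn -mulrDr cos2Dsin2 mulr1 sqrtr_sqr.
by rewrite ger0_norm ?expR_ge0.
Qed.

Lemma cexp_neq0 z : cexp z != 0.
Proof. by rewrite -normr_gt0 norm_cexp ltcR expR_gt0. Qed.

Lemma cexpN z : cexp (- z) = (cexp z)^-1.
Proof.
by apply: (mulIf (cexp_neq0 z)); rewrite -cexpD addNr cexp0 mulVf ?cexp_neq0.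
Qed.

Lemma cexp_pii : cexp (0 +i* pi : R[i]) = -1.
Proof. by rewrite /cexp /= expR0 !mul1r cospi sinpi; simpc. Qed.

Lemma cexp_twopii : cexp (twopii R) = 1.
Proof.
have -> : twopii R = (0 +i* pi) + (0 +i* pi).
  apply/eqP; rewrite eq_complex /= addr0 eqxx /=.
  by apply/eqP; ring.
by rewrite cexpD cexp_pii mulrNN mulr1.
Qed.

Lemma cexp_twopii_int (n : int) : cexp (twopii R * n%:~R) = 1.
Proof.
have cexp_nat (k : nat) : cexp (twopii R * k%:R) = 1.
  elim: k => [|k IH]; first by rewrite mulr0 cexp0.
  by rewrite -addn1 natrD mulrDr cexpD IH mulr1 cexp_twopii mulr1.
case: n => n; first exact: cexp_nat.
by rewrite NegzE intrN mulrN cexpN cexp_nat invr1.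
Qed.

Lemma upowD t u s : upow (t + u) s = cexp (u * s) * upow t s.
Proof. by rewrite /upow mulrDr cexpD mulrC [u * s]mulrC. Qed.

Lemma norm_upow (u : R) t : `|upow t u%:C| = (expR (u * complex.Re t))%:C.
Proof. by rewrite /upow norm_cexp; case: t => x y /=; rewrite mul0r subr0. Qed.

Lemma le_norm_Re z (r : R) : `|z| <= r%:C -> `|complex.Re z| <= r.
Proof.
rewrite normc_def lecR; apply: le_trans.
by rewrite -sqrtr_sqr ler_sqrt ?lerDl ?sqr_ge0 // addr_ge0 ?sqr_ge0.
Qed.

Lemma real_complex_ratio (j n : nat) :
  (j%:R / n%:R : R[i]) = (j%:R / n%:R : R)%:C.
Proof. by rewrite rmorphM fmorphV !rmorph_nat. Qed.

End Cexp.

(** * Functions of polynomial growth along a ray *)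

Section Growth.
Variable R : realType.
Implicit Types (d y : R) (h : R -> R[i]).

(** With x = e^(s + iy), this is h = O(|x|^d) along the ray of argument y.
    Asking for the bound on the whole half-line |x| >= 1 makes the class stable
    under sums without a maximum of thresholds. *)
Definition dominated d h :=
  exists L : R, forall s : R, 0 <= s -> `|h s| <= (L * expR (d * s))%:C.

Lemma dominatedD d h1 h2 :
  dominated d h1 -> dominated d h2 -> dominated d (fun s => h1 s + h2 s).
Proof.
move=> [L1 H1] [L2 H2]; exists (L1 + L2) => s s0.
apply: le_trans (ler_normD _ _) _.
by rewrite mulrDl rmorphD lerD ?H1 ?H2.
Qed.

Lemma dominated0 d : dominated d (fun=> 0).
Proof. by exists 0 => s _; rewrite normr0 mul0r. Qed.

Lemma dominated_sum d (I : Type) (r : seq I) (P : pred I) (F : I -> R -> R[i]) :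
  (forall i, P i -> dominated d (F i)) ->
  dominated d (fun s => \sum_(i <- r | P i) F i s).
Proof.
move=> H; elim: r => [|i r IH].
  by case: (dominated0 d) => L HL; exists L => s s0; rewrite big_nil HL.
case: (boolP (P i)) => Pi.
  case: (dominatedD (H i Pi) IH) => L HL; exists L => s s0.
  by rewrite big_cons Pi HL.
by case: IH => L HL; exists L => s s0; rewrite big_cons (negPf Pi) HL.
Qed.

Lemma dominatedMl d c h : dominated d h -> dominated d (fun s => c * h s).
Proof.
move=> [L HL]; exists (complex.Re `|c| * L) => s s0.
have cE : `|c| = (complex.Re `|c|)%:C by rewrite RRe_real ?normr_real.
by rewrite normrM -mulrA rmorphM /= -cE ler_wpM2l // HL.
Qed.

Lemma dominated_upow d u y : u <= d ->
  dominated d (fun s => upow (s +i* y) u%:C).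
Proof.
move=> ud; exists 1 => s s0.
by rewrite norm_upow lecR /= mul1r ler_expR ler_wpM2r.
Qed.

Lemma dominated_log d y : 0 < d -> dominated d (fun s => s +i* y).
Proof.
move=> d0; exists (d^-1 + `|y|) => s s0.
have -> : s +i* y = s%:C + 'i * y%:C by rewrite [LHS]complexE.
apply: le_trans (ler_normD _ _) _.
have ni : `|'i : R[i]| = 1 by rewrite normc_def /= expr0n expr1n add0r sqrtr1.
rewrite normrM ni mul1r !normc_def /= !expr0n !addr0 -rmorphD lecR !sqrtr_sqr.
have e1 := expR_ge1Dx (d * s).
have ds0 : 0 <= d * s by rewrite mulr_ge0 // ltW.
rewrite mulrDl lerD //.
  rewrite ger0_norm // mulrC ler_pdivlMr // [s * d]mulrC.
  by rewrite (le_trans _ e1) // lerDr.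
by rewrite ler_peMr // (le_trans _ e1) // lerDl.
Qed.

(** With e^s = |x|, the difference is
    |x|^(m/2 - 1/4) ((2/m) |x|^(1/4) - L).  The exponent m/2 - 1/4 exceeds
    m/2 - 1, the largest power in S after the leading one, and it is positive
    even for m = 1, so that it also absorbs the term r ln x. *)
Lemma exp_beats_dominated (m : nat) (L X : R) : (0 < m)%N ->
  exists T : R, forall s, T <= s ->
  X <= 2 / m%:R * expR (m%:R / 2 * s) - L * expR ((m%:R / 2 - 1 / 4) * s).
Proof.
move=> m0; have mR : (0 < m%:R :> R) by rewrite ltr0n.
have m1 : (1 <= m%:R :> R) by rewrite ler1n.
(* Chosen so that (2/m) (s/4), a lower bound of (2/m) e^(s/4), is at least
   |X| + |L|. *)
exists (2 * m%:R * (`|X| + `|L|)) => s sT.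
have nX := normr_ge0 X; have nL := normr_ge0 L.
have s0 : 0 <= s by apply: le_trans sT; rewrite !mulr_ge0 ?addr_ge0 // ltW.
have -> : m%:R / 2 * s = s / 4 + (m%:R / 2 - 1 / 4) * s by field.
rewrite expRD mulrA -mulrBl.
have e1 : s / 4 <= expR (s / 4).
  by apply: le_trans (expR_ge1Dx _); rewrite lerDr.
have big : `|X| <= 2 / m%:R * expR (s / 4) - L.
  have : 2 / m%:R * (2 * m%:R * (`|X| + `|L|) / 4) <= 2 / m%:R * expR (s / 4).
    by rewrite ler_wpM2l // (le_trans _ e1) // ler_wpM2r.
  have -> : 2 / m%:R * (2 * m%:R * (`|X| + `|L|) / 4) = `|X| + `|L|.
    by field; rewrite gt_eqF.
  have := ler_norm L; lra.
have e2 : 1 <= expR ((m%:R / 2 - 1 / 4) * s).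
  rewrite -[leLHS]expR0 ler_expR mulr_ge0 //; lra.
apply: le_trans (ler_norm X) _; apply: le_trans (big) _.
by rewrite ler_peMr // (le_trans nX).
Qed.

End Growth.

(** * Growth and decay of the subdominant solution *)

Section Infinity.
Variables (R : realType) (m : nat).
Hypothesis m_gt0 : (0 < m)%N.
Variables (b : 'rV[R[i]]_m -> nat -> R[i]) (Phi0 : R[i] -> 'rV[R[i]]_m -> R[i]).
Hypothesis asymPhi0 : asymptotic_inf b Phi0.

(** The logarithm of the leading factor x^r e^(- S), on which growth estimates
    become additive. *)
Definition log_leading (a : 'rV[R[i]]_m) (t : R[i]) : R[i] :=
  r_inf b a * t - S_inf b t a.

Lemma cexp_log_leading a t :
  cexp (log_leading a t) = upow t (r_inf b a) * cexp (- S_inf b t a).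
Proof. by rewrite cexpD. Qed.

(** In r ln x - S, everything besides - (2/m) x^(m/2) is a logarithm or a power
    of exponent at most m/2 - 1, hence negligible against that term. *)
Lemma log_leading_dominated a y :
  dominated (m%:R / 2 - 1 / 4) (fun s : R =>
    log_leading a (s +i* y) + 2 / m%:R * upow (s +i* y) (m%:R / 2)).
Proof.
have m1 : (1 <= m%:R :> R) by rewrite ler1n.
have -> : (fun s : R =>
      log_leading a (s +i* y) + 2 / m%:R * upow (s +i* y) (m%:R / 2)) =
    (fun s : R => r_inf b a * (s +i* y) +
      \sum_(1 <= k < m | (1 <= k < m)%N && (k.*2 < m)%N)
        - (b a k / (m%:R / 2 - k%:R)) *
          upow (s +i* y) (m%:R / 2 - k%:R : R)%:C).
  apply/funext => s; rewrite /log_leading /S_inf big_nat_cond.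
  rewrite opprD -!addrA; congr (_ + _); rewrite addrCA addNr addr0 -sumrN.
  apply: eq_bigr => k _; rewrite mulNr; congr (- (_ * upow _ _)).
  by rewrite rmorphB rmorphM fmorphV !rmorph_nat.
apply: dominatedD.
  by apply/dominatedMl/dominated_log; lra.
apply: dominated_sum => k /andP[/andP[k1 _] _].
apply/dominatedMl/dominated_upow.
have : (1 <= k%:R :> R) by rewrite ler1n.
lra.
Qed.

(** The expansion cut after its constant term 1: the remainder is
    O(|x|^(-1/2)) uniformly in the closed sector - 2 pi / m <= arg x <= 0,
    which contains both rays on which Phi_0 is evaluated. *)
Lemma Phi0_eventually (a : 'rV[R[i]]_m) : exists T : R, forall t : R[i],
  - (2 * pi / m%:R) <= complex.Im t <= 0 -> T <= complex.Re t ->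
  `|Phi0 t a / cexp (log_leading a t) - 1| <= (1 / 2)%:C.
Proof.
have mR : (0 < m%:R :> R) by rewrite ltr0n.
case: asymPhi0 => c [c0 H].
have [|| K [rho /nbhs_singleton B]] := H (- (2 * pi / m%:R)) 0 _ _ 1%N a.
- by rewrite ltrN2 ltr_pM2r ?invr_gt0 // ltr_pM2r ?pi_gt0 // ltr_nat.
- by rewrite divr_gt0 // mulr_gt0 // pi_gt0.
(* By 1 + u <= e^u, the summand |rho| gives rho < |x|, and 4 |K| gives
   |K| |x|^(-1/2) <= 1/2. *)
exists (4 * `|K| + `|rho|) => t tI tT.
have nK := normr_ge0 K; have nr := normr_ge0 rho.
have /B {B} := tI; rewrite norm_cexp ltcR big_ord1 c0 mul0r oppr0 mul1r.
rewrite [upow t 0]/upow mul0r cexp0 -cexp_log_leading.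
have rho_lt : rho < expR (complex.Re t).
  by apply: lt_le_trans (expR_ge1Dx _); have := ler_norm rho; lra.
move=> /(_ rho_lt) B; apply: le_trans B _.
pose st : R := if odd m then 1 / 2 else 1.
have -> : - (1%:R * step_inf R m) = (- st)%:C.
  rewrite mul1r /step_inf /st rmorphN; congr (- _).
  by case: odd => //; rewrite rmorphM fmorphV /= -!natr1 !rmorphD.
rewrite norm_upow -rmorphM lecR.
have st_ge : 1 / 2 <= st by rewrite /st; case: odd => //; lra.
have t0 : 0 <= complex.Re t by lra.
apply: le_trans (ler_wpM2r (expR_ge0 _) (ler_norm K)) _.
apply: (@le_trans _ _ (`|K| * expR (- (1 / 2 * complex.Re t)))).
  by rewrite ler_wpM2l // ler_expR mulNr lerN2 ler_wpM2r.
rewrite expRN ler_pdivrMr ?expR_gt0 //.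
have := expR_ge1Dx (1 / 2 * complex.Re t); lra.
Qed.

Lemma upow_pos_ray (s : R) :
  upow (s +i* 0) (m%:R / 2) = (expR (m%:R / 2 * s))%:C.
Proof.
rewrite [_ / 2]real_complex_ratio /upow /cexp /=.
by rewrite !mul0r !mulr0 subr0 addr0 cos0 sin0 mulr1 mulr0.
Qed.

Lemma upow_neg_ray (s : R) :
  upow (s +i* (- (2 * pi / m%:R))) (m%:R / 2) = (- expR (m%:R / 2 * s))%:C.
Proof.
have mR : (m%:R != 0 :> R) by rewrite pnatr_eq0 -lt0n.
rewrite [_ / 2]real_complex_ratio /upow /cexp /= !mul0r subr0 addr0.
have -> : m%:R / 2 * - (2 * pi / m%:R) = - pi :> R by field.
by rewrite cosN sinN cospi sinpi oppr0 mulr0 mulrN1.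
Qed.

Lemma Re_log_leading_pos_ray a (X : R) : exists T : R, forall s, T <= s ->
  complex.Re (log_leading a (s +i* 0)) <= - X.
Proof.
case: (log_leading_dominated a 0) => L HL.
case: (exp_beats_dominated L X m_gt0) => T HT; exists (`|T|) => s sT.
have s0 : 0 <= s by apply: le_trans sT.
have {HT} := HT s (le_trans (ler_norm T) sT).
have /le_norm_Re := HL s s0.
rewrite upow_pos_ray real_complex_ratio -rmorphM /=.
case: (log_leading a _) => u v /=; rewrite ler_norml => /andP[_]; lra.
Qed.

Lemma Re_log_leading_neg_ray a (X : R) : exists T : R, forall s, T <= s ->
  X <= complex.Re (log_leading a (s +i* (- (2 * pi / m%:R)))).
Proof.
case: (log_leading_dominated a (- (2 * pi / m%:R))) => L HL.
case: (exp_beats_dominated L X m_gt0) => T HT; exists (`|T|) => s sT.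
have s0 : 0 <= s by apply: le_trans sT.
have {HT} := HT s (le_trans (ler_norm T) sT).
have /le_norm_Re := HL s s0.
rewrite upow_neg_ray real_complex_ratio -rmorphM /=.
case: (log_leading a _) => u v /=; rewrite ler_norml => /andP[+ _]; lra.
Qed.

Lemma Phi0_recessive a : exists T : R, forall s, T <= s ->
  Phi0 (s +i* 0) a != 0 /\ `|Phi0 (s +i* 0) a| <= 2.
Proof.
case: (Phi0_eventually a) => T1 H1.
case: (Re_log_leading_pos_ray a 0) => T2 H2.
exists (`|T1| + `|T2|) => s sT.
have [nT1 nT2] := (normr_ge0 T1, normr_ge0 T2).
have [sT1 sT2] : T1 <= s /\ T2 <= s.
  by have [] := (ler_norm T1, ler_norm T2); split; lra.
have {H1} := H1 (s +i* 0); rewrite /= lexx andbT => /(_ _ sT1).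
have -> : - (2 * pi / m%:R) <= 0 :> R.
  by rewrite oppr_le0 divr_ge0 // mulr_ge0 // pi_ge0.
have {H2} := H2 s sT2; set Q := log_leading _ _ => HQ /(_ isT) H1.
have Q0 := cexp_neq0 Q; split.
  apply/eqP => E; move: H1; rewrite E mul0r sub0r normrN normr1.
  rewrite -[leLHS]/(1%:C) lecR; lra.
rewrite -[Phi0 _ _](divfK Q0) normrM norm_cexp.
have eQ : expR (complex.Re Q) <= 1 by rewrite -expR0 ler_expR; lra.
apply: (@le_trans _ _ (2 * 1)); last by rewrite mulr1.
apply: ler_pM => //; first by rewrite ler0c expR_ge0.
  rewrite -[_ / _](subrK 1); apply: le_trans (ler_normD _ _) _.
  have -> : 2 = 1 + 1 :> R[i] by ring.
  rewrite normr1 lerD2r (le_trans H1) // -[leRHS]/(1%:C) lecR; lra.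
by rewrite -[leRHS]/(1%:C) lecR.
Qed.

Lemma Phi0_dominant a (X : R) : exists T : R, forall s, T <= s ->
  X%:C <= `|Phi0 (s +i* (- (2 * pi / m%:R))) a|.
Proof.
case: (Phi0_eventually a) => T1 H1.
case: (Re_log_leading_neg_ray a (2 * X)) => T2 H2.
exists (`|T1| + `|T2|) => s sT.
have [nT1 nT2] := (normr_ge0 T1, normr_ge0 T2).
have [sT1 sT2] : T1 <= s /\ T2 <= s.
  by have [] := (ler_norm T1, ler_norm T2); split; lra.
have {H1} := H1 (s +i* (- (2 * pi / m%:R))); rewrite /= lexx => /(_ _ sT1).
have -> : - (2 * pi / m%:R) <= 0 :> R.
  by rewrite oppr_le0 divr_ge0 // mulr_ge0 // pi_ge0.
have {H2} := H2 s sT2; set Q := log_leading _ _ => HQ /(_ isT) H1.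
have Q0 := cexp_neq0 Q.
rewrite -[Phi0 _ _](divfK Q0) normrM norm_cexp.
have eQ : 2 * X <= expR (complex.Re Q).
  by apply: le_trans HQ (le_trans _ (expR_ge1Dx _)); rewrite lerDr.
have half : (1 / 2 : R)%:C <= `|Phi0 (s +i* (- (2 * pi / m%:R))) a / cexp Q|.
  have := lerB_dist 1 (1 - Phi0 (s +i* (- (2 * pi / m%:R))) a / cexp Q).
  rewrite subKr normr1 distrC; apply: le_trans.
  rewrite lerBrDr (le_trans (lerD (lexx _) H1)) // -rmorphD.
  rewrite -[leRHS]/(1%:C) lecR; lra.
apply: le_trans (ler_wpM2r _ half); last by rewrite ler0c expR_ge0.
rewrite -rmorphM lecR; lra.
Qed.

(** On the positive axis, a relation with c != 0 would equate the unbounded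
    c Phi_(-1) with the bounded - d Phi_0.  So c = 0, and then d = 0 because
    Phi_0 does not vanish far out. *)
Lemma Phi_adjacent_independent (a : 'rV[R[i]]_m) (c d : R[i]) :
  (forall t, c * Phi Phi0 (-1) t a + d * Phi Phi0 0 t a = 0) -> c = 0 /\ d = 0.
Proof.
have Phi_0 t : Phi Phi0 0 t a = Phi0 t a.
  rewrite /Phi /Defs.rot /omega mulr0 mul0r addr0 cexp0; congr (Phi0 _ _).
  by apply/rowP => j; rewrite mxE expr1n mul1r.
have Phi_m1 s : Phi Phi0 (-1) (s +i* 0) a =
    Phi0 (s +i* (- (2 * pi / m%:R))) (act (omega R m (-1)) a).
  rewrite /Phi /Defs.rot; congr Phi0.
  have -> : (m%:R : R[i])^-1 = (m%:R^-1 : R)%:C by rewrite fmorphV rmorph_nat.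
  rewrite mulrN1 /twopii; apply/eqP; rewrite eq_complex /=.
  by apply/andP; split; apply/eqP; ring.
move=> H.
have {H} H s : c * Phi0 (s +i* (- (2 * pi / m%:R))) (act (omega R m (-1)) a)
    = - (d * Phi0 (s +i* 0) a).
  by apply/eqP; rewrite -addr_eq0 -Phi_0 -Phi_m1 H.
have [T0 H0] := Phi0_recessive a.
have c0 : c = 0.
  apply/eqP/negP => /negP c_neq0.
  pose B : R := complex.Re `|d / c|.
  have BE : `|d / c| = B%:C by rewrite RRe_real ?normr_real.
  have [T1 H1] := Phi0_dominant (act (omega R m (-1)) a) (B * 2 + 1).
  pose s := Num.max T0 T1.
  have [sT0 sT1] : T0 <= s /\ T1 <= s by rewrite !le_max !lexx orbT.
  have [_ le2] : _ /\ _ := H0 s sT0.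
  have := H1 s sT1.
  have -> : Phi0 (s +i* (- (2 * pi / m%:R))) (act (omega R m (-1)) a)
      = - (d / c * Phi0 (s +i* 0) a).
    by apply: (mulfI c_neq0); rewrite H; field.
  rewrite normrN normrM BE => big.
  have : (B * 2 + 1)%:C <= (B * 2)%:C.
    apply: le_trans big _; rewrite rmorphM rmorph_nat ler_wpM2l //.
    by rewrite -BE normr_ge0.
  by rewrite lecR; lra.
split=> //.
have [/eqP ne _] := H0 T0 (lexx _).
have := H T0; rewrite c0 mul0r => /esym/eqP; rewrite oppr_eq0 mulf_eq0.
by case/orP => /eqP.
Qed.

End Infinity.

(** * Continuation around the origin *)

Section Continuation.
Variables (R : realType) (m : nat).
Hypothesis m_gt0 : (0 < m)%N.

Lemma Phi_full_turn (Phi0 : R[i] -> 'rV[R[i]]_m -> R[i]) (k : int) t a :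
  Phi Phi0 (k + m%:Z) t a = Phi Phi0 k (t + twopii R) a.
Proof.
have mC : (m%:R != 0 :> R[i]) by rewrite pnatr_eq0 -lt0n.
have shift : twopii R * (k + m%:Z)%:~R / m%:R =
    twopii R + twopii R * k%:~R / m%:R.
  by rewrite intrD pmulrn; field.
by rewrite /Phi /Defs.rot /omega shift cexpD cexp_twopii mul1r addrA.
Qed.

Lemma ord2_ind (P : 'I_2 -> Prop) : P 0 -> P 1 -> forall i, P i.
Proof.
move=> P0 P1 [[|[|//]] lt_i2].
- by rewrite (_ : Ordinal lt_i2 = 0) //; apply/val_inj.
- by rewrite (_ : Ordinal lt_i2 = 1) //; apply/val_inj.
Qed.

Lemma mulmx_col2 n (A : 'M[R[i]]_(n, 2)) (x y : R[i]) (i : 'I_n) :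
  (A *m col2 x y) i 0 = A i 0 * x + A i 1 * y.
Proof.
rewrite mxE !big_ord_recl big_ord0 !mxE /= addr0.
by rewrite (_ : lift ord0 ord0 = 1) //; apply/val_inj.
Qed.

Lemma col2_mulmx (u v w z x y : R[i]) :
  mx2 u v w z *m col2 x y = col2 (u * x + v * y) (w * x + z * y).
Proof.
by apply/colP; apply: ord2_ind; rewrite mulmx_col2 !mxE.
Qed.

Lemma prod_Stokes_Sibuya (Phi0 : R[i] -> 'rV[R[i]]_m -> R[i]) S :
  is_Stokes_Sibuya Phi0 S -> forall n a t,
  col2 (Phi Phi0 (-1) t a) (Phi Phi0 0 t a) =
  \prod_(k < n) S (Posz k) a *m
    col2 (Phi Phi0 (n%:Z - 1) t a) (Phi Phi0 n%:Z t a).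
Proof.
move=> hS n a t; elim: n => [|n ->]; first by rewrite big_ord0 mul1mx.
rewrite big_ord_recr /= (hS n%:Z a t) mulmxA.
by rewrite intS addrAC subrr add0r addrC.
Qed.

(** A turn multiplies f_1 by e^(2 i pi s(p)) and adds 2 i pi to ln x, so f_2
    picks up 2 i pi lambda e^(2 i pi s(p)) f_1, while the matrix has s(-p)
    there.  The two agree: lambda vanishes unless p is an integer, and
    s(p) - s(-p) = p. *)
Lemma monodromyP (f1 f2 : R[i] -> 'rV[R[i]]_m.-1 -> R[i] -> R[i])
  (lambda : 'rV[R[i]]_m.-1 -> R[i] -> R[i]) (a' : 'rV[R[i]]_m.-1) (p : R[i]) :
  origin_system f1 f2 lambda -> admissible p -> forall t,
  col2 (f1 (t + twopii R) a' p) (f2 (t + twopii R) a' p) =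
  monodromy lambda a' p *m col2 (f1 t a' p) (f2 t a' p).
Proof.
move=> [g1 [g2 H]] hp; have [_ Ef1 Ef2 _ [B _ [lam0 _ _]]] := H a' p hp => t.
have lam_exp : lambda a' p * cexp (twopii R * s_exp p) =
    lambda a' p * cexp (twopii R * s_exp (- p)).
  have [[n pn]|pZ] := pselect (exists n : int, p = n%:~R); last first.
    have [n pn|-> _] := lam0; first by apply: pZ; exists n.
    by rewrite !mul0r.
  have -> : s_exp p = s_exp (- p) + n%:~R by rewrite /s_exp pn; field.
  by rewrite mulrDr cexpD cexp_twopii_int mulr1.
have cexp_turn : cexp (t + twopii R) = cexp t.
  by rewrite cexpD cexp_twopii mulr1.
have f1_turn : f1 (t + twopii R) a' p = cexp (twopii R * s_exp p) * f1 t a' p.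
  by rewrite !Ef1 upowD cexp_turn mulrA.
rewrite /monodromy col2_mulmx mul0r addr0 f1_turn; congr col2.
rewrite Ef2 f1_turn upowD cexp_turn (Ef2 t) mulrA lam_exp.
by ring.
Qed.

Lemma monodromy_unit (lambda : 'rV[R[i]]_m.-1 -> R[i] -> R[i]) a' p :
  monodromy lambda a' p \in unitmx.
Proof.
rewrite unitmxE det_trig; last first.
  by apply/is_trig_mxP; elim/ord2_ind; elim/ord2_ind; rewrite ?mxE.
by rewrite !big_ord_recl big_ord0 !mxE /= mulr1 unitfE mulf_neq0 ?cexp_neq0.
Qed.

Lemma fundamental_system_cancel (a : 'rV[R[i]]_m) (F G : R[i] -> R[i])
    (A B : 'M[R[i]]_2) :
  fundamental_system a F G ->
  (forall t, A *m col2 (F t) (G t) = B *m col2 (F t) (G t)) -> A = B.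
Proof.
move=> [_ _ indep] AB; apply/matrixP => i.
have [t|E0 E1] := indep (A i 0 - B i 0) (A i 1 - B i 1).
  move/colP/(_ i): (AB t); rewrite !mulmx_col2 => E.
  by rewrite !mulrBl addrACA -opprD E subrr.
by apply: ord2_ind; apply/eqP; rewrite -subr_eq0 ?E0 ?E1.
Qed.

End Continuation.

Theorem theorem6p2 (R : realType) (m : nat) (hm : (1 <= m)%N)
  (b : 'rV[R[i]]_m -> nat -> R[i]) (hb : sqrt_expansion b)
  (Phi0 : R[i] -> 'rV[R[i]]_m -> R[i]) (hPhi0 : is_Phi0 b Phi0)
  (S : int -> 'rV[R[i]]_m -> 'M[R[i]]_2) (hS : is_Stokes_Sibuya Phi0 S)
  (f1 f2 : R[i] -> 'rV[R[i]]_m.-1 -> R[i] -> R[i])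
  (lambda : 'rV[R[i]]_m.-1 -> R[i] -> R[i])
  (hf : origin_system f1 f2 lambda)
  (M : int -> 'rV[R[i]]_m.-1 -> R[i] -> 'M[R[i]]_2)
  (hM : is_connection Phi0 f1 f2 M)
  (a' : 'rV[R[i]]_m.-1) (p : R[i]) (hp : admissible p) :
  \prod_(k < m) S (Posz k) (param a' p)
  = M 0 a' p *m invmx (monodromy lambda a' p) *m invmx (M 0 a' p).
Proof.
set N := monodromy lambda a' p; set P := \prod_(k < m) _.
have fund : fundamental_system (param a' p) (f1 ^~ a' ^~ p) (f2 ^~ a' ^~ p).
  by have [g1 [g2 /(_ a' p hp) []]] := hf.
have M_unit : M 0 a' p \in unitmx.
  have [_ asym _] := hPhi0.
  rewrite unitmxE unitfE; apply/det0P => -[v v_neq0 vM].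
  have [t|v0 v1] := @Phi_adjacent_independent _ _ hm _ _ asym
    (param a' p) (v 0 0) (v 0 1).
    have := congr1 (mulmx v) (hM 0 a' p hp t).
    by rewrite mulmxA vM mul0mx => /rowP/(_ 0); rewrite mulmx_col2 mxE.
  by case/eqP: v_neq0; apply/rowP; apply: ord2_ind; rewrite mxE.
have MPMN : M 0 a' p = P *m (M 0 a' p *m N).
  apply: (fundamental_system_cancel fund) => t.
  rewrite -(hM 0 a' p hp t) -[P *m _ *m _]mulmxA -[M 0 a' p *m N *m _]mulmxA.
  rewrite -(monodromyP _ hf hp t) -(hM 0 a' p hp (t + twopii R)).
  by rewrite (prod_Stokes_Sibuya hS m) -!Phi_full_turn // addrC add0r.
apply: (can_inj (mulmxK M_unit)); rewrite mulmxKV //.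
by rewrite {2}MPMN -mulmxA mulmxK ?monodromy_unit.
Qed.
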